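(* Let $k\geqslant 2$ be a fixed integer and let $V=V_k$ be the set of $k$-free integers in $\mathcal{O}=\mathbb{Z}[\sqrt{-2}]$. Let $A$ be a $\mathbb{Z}$-linear bijection of $\mathcal{O}$ with $A(V)\subseteq V$. Then $A$ is of the form $A(x)=\varepsilon\,\sigma(x)$ with $\varepsilon\in\mathcal{O}^{\times}=\{\pm1\}\simeq C_2$ and $\sigma\in\{\mathrm{id},\bar{\,\cdot\,}\}\simeq C_2$, where $\bar{\,\cdot\,}$ is complex conjugation. Consequently, $A(V)=V$, and these mappings form the group $\mathrm{stab}(V)\simeq C_2\times C_2$.
   Context: An element $x\in\mathcal{O}=\mathbb{Z}[\sqrt{-2}]$ (a principal ideal domain, the ring of integers of $\mathbb{Q}(\sqrt{-2})$) is $k$-free if it is not divisible by the $k$-th power of any prime of $\mathcal{O}$; in particular, $0$ is not $k$-free. $\mathrm{stab}(V)$ is the monoid (under composition) of all $\mathbb{Z}$-linear bijections $A$ of $\mathcal{O}$ with $A(V)\subseteq V$. $C_2$ is the cyclic group of order $2$. *)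

(* Defs.v *)
From HB Require Import structures.
From mathcomp Require Import all_boot all_order all_algebra all_fingroup.
From mathcomp Require Import ring lra.
From mathcomp Require Import boolp classical_sets functions.

Set Implicit Arguments.
Unset Strict Implicit.
Unset Printing Implicit Defensive.

Import Order.TTheory GRing.Theory Num.Theory.
Local Open Scope ring_scope.
Local Open Scope classical_set_scope.

(* [Zsqrtm2_of a b] stands for a + b * sqrt(-2); see [toC] below. *)
Record Zsqrtm2 := Zsqrtm2_of { zre : int; zim : int }.

Definition pair_of_Zsqrtm2 (x : Zsqrtm2) := (zre x, zim x).
Definition Zsqrtm2_of_pair (p : int * int) := Zsqrtm2_of p.1 p.2.

Lemma pair_of_Zsqrtm2K : cancel pair_of_Zsqrtm2 Zsqrtm2_of_pair.
Proof. by case. Qed.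

HB.instance Definition _ := Countable.copy Zsqrtm2 (can_type pair_of_Zsqrtm2K).

Section RingStructure.
Implicit Types x y z : Zsqrtm2.

Definition zzero := Zsqrtm2_of 0 0.
Definition zone := Zsqrtm2_of 1 0.
Definition zopp x := Zsqrtm2_of (- zre x) (- zim x).
Definition zadd x y := Zsqrtm2_of (zre x + zre y) (zim x + zim y).
Definition zmul x y :=
  Zsqrtm2_of (zre x * zre y - 2 * (zim x * zim y))
             (zre x * zim y + zim x * zre y).

Lemma zaddA : associative zadd.
Proof. by case=> a b [c d] [e f]; rewrite /zadd /= !addrA. Qed.

Lemma zaddC : commutative zadd.
Proof. by case=> a b [c d]; rewrite /zadd /= addrC [b + d]addrC. Qed.

Lemma zadd0 : left_id zzero zadd.
Proof. by case=> a b; rewrite /zadd /= !add0r. Qed.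

Lemma zaddN : left_inverse zzero zopp zadd.
Proof. by case=> a b; rewrite /zadd /= !addNr. Qed.

HB.instance Definition _ :=
  GRing.isZmodule.Build Zsqrtm2 zaddA zaddC zadd0 zaddN.

Lemma zmulA : associative zmul.
Proof. by case=> a b [c d] [e f]; rewrite /zmul /=; congr Zsqrtm2_of; ring. Qed.

Lemma zmulC : commutative zmul.
Proof. by case=> a b [c d]; rewrite /zmul /=; congr Zsqrtm2_of; ring. Qed.

Lemma zmul1 : left_id zone zmul.
Proof. by case=> a b; rewrite /zmul /=; congr Zsqrtm2_of; ring. Qed.

Lemma zmulDl : left_distributive zmul zadd.
Proof.
by case=> a b [c d] [e f]; rewrite /zmul /zadd /=; congr Zsqrtm2_of; ring.
Qed.

Lemma zone_neq0 : zone != 0.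
Proof. by []. Qed.

HB.instance Definition _ :=
  GRing.Zmodule_isComNzRing.Build Zsqrtm2 zmulA zmulC zmul1 zmulDl zone_neq0.

Definition zconj x := Zsqrtm2_of (zre x) (- zim x).
Definition znorm x : int := zre x ^+ 2 + 2 * zim x ^+ 2.

Definition zunit : {pred Zsqrtm2} := fun x => znorm x == 1.
Definition zinv x := if x \in zunit then zconj x else x.

Lemma znormM x y : znorm (x * y) = znorm x * znorm y.
Proof.
case: x y => a b [c d]; rewrite [Zsqrtm2_of a b * _]/(zmul _ _) /znorm /=; ring.
Qed.

Lemma zconjM x : zconj x * x = Zsqrtm2_of (znorm x) 0.
Proof.
case: x => a b; rewrite [LHS]/(zmul _ _) /zmul /znorm /=.
by congr Zsqrtm2_of; ring.
Qed.

Lemma zmulVx : {in zunit, left_inverse 1 zinv *%R}.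
Proof. by move=> x xu; rewrite /zinv xu zconjM (eqP xu). Qed.

Lemma zunitP x y : y * x = 1 -> x \in zunit.
Proof.
move=> /(congr1 znorm); rewrite znormM => yx1.
have norm_ge0 u : 0 <= znorm u.
  by rewrite addr_ge0 ?sqr_ge0 // mulr_ge0 ?sqr_ge0.
have : znorm x \is a GRing.unit by apply/unitrPr; exists (znorm y); rewrite mulrC.
rewrite unfold_in /= -topredE /= /zunit; move: (norm_ge0 x).
by case: (znorm x) => n //= _ /orP[].
Qed.

Lemma zinv_out : {in [predC zunit], zinv =1 id}.
Proof. by move=> x /negPf xNu; rewrite /zinv xNu. Qed.

HB.instance Definition _ :=
  GRing.ComNzRing_hasMulInverse.Build Zsqrtm2 zmulVx zunitP zinv_out.

End RingStructure.

(* The embedding of Z[sqrt(-2)] into the complex numbers; it turns [zconj] into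
   complex conjugation. *)
Section ComplexEmbedding.
Variable C : numClosedFieldType.

Definition toC (x : Zsqrtm2) : C :=
  (zre x)%:~R + (zim x)%:~R * ('i * sqrtC 2).

Lemma toC_zmod_morphism : zmod_morphism toC.
Proof. by case=> a b [c d]; rewrite /toC /= !rmorphB /=; ring. Qed.

Lemma toC_monoid_morphism : monoid_morphism toC.
Proof.
split=> [|[a b] [c d]]; first by rewrite /toC /= mul0r addr0.
rewrite [Zsqrtm2_of a b * _]/(zmul _ _) /toC /= !(rmorphB, rmorphD, rmorphM) /=.
have s2 : ('i * sqrtC 2) ^+ 2 = - 2 :> C by rewrite exprMn sqrCi sqrtCK mulN1r.
ring: s2.
Qed.

HB.instance Definition _ :=
  GRing.isZmodMorphism.Build Zsqrtm2 C toC toC_zmod_morphism.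
HB.instance Definition _ :=
  GRing.isMonoidMorphism.Build Zsqrtm2 C toC toC_monoid_morphism.

Lemma toC_conj x : toC (zconj x) = (toC x)^*.
Proof.
have conj_s2 : (sqrtC 2)^* = sqrtC 2 :> C.
  by apply/CrealP; rewrite ger0_real ?sqrtC_ge0.
rewrite /toC /= rmorphD !rmorphM /= conjCi conj_s2 !rmorph_int rmorphN /=.
by rewrite !mulNr mulrN.
Qed.

Lemma toC_inj : injective toC.
Proof.
apply: raddf_inj => x /(congr1 (fun z => toC (zconj x) * z)).
rewrite mulr0 -rmorphM /= zconjM /toC /= mul0r addr0 => /eqP.
rewrite intr_eq0 /znorm; case: x => a b /=.
rewrite paddr_eq0 ?sqr_ge0 ?(mulr_ge0 _ (sqr_ge0 _)) //.
rewrite sqrf_eq0 mulf_eq0 sqrf_eq0 /=.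
by move=> /andP[/eqP-> /eqP->].
Qed.

End ComplexEmbedding.

Section KFree.
Implicit Types p x y : Zsqrtm2.

Definition zdvd x y := exists z, y = z * x.

Definition zprime p :=
  [/\ p != 0, p \isn't a GRing.unit &
      forall x y, zdvd p (x * y) -> zdvd p x \/ zdvd p y].

Definition kfree (k : nat) : set Zsqrtm2 :=
  [set x | ~ exists2 p, zprime p & zdvd (p ^+ k) x].

End KFree.

Definition zlinear (A : Zsqrtm2 -> Zsqrtm2) :=
  linear (A : zmodule Zsqrtm2 -> zmodule Zsqrtm2).

Definition stab (V : set Zsqrtm2) : set (Zsqrtm2 -> Zsqrtm2) :=
  [set A | [/\ zlinear A, bijective A & A @` V `<=` V]].

Definition is_group (T : Type) (op : T -> T -> T) (e : T) (G : set T) :=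
  [/\ G e,
      forall x y, G x -> G y -> G (op x y),
      forall x y z, G x -> G y -> G z -> op x (op y z) = op (op x y) z,
      forall x, G x -> op e x = x /\ op x e = x &
      forall x, G x -> exists2 y, G y & op y x = e /\ op x y = e].

Definition group_isog (T : Type) (op : T -> T -> T) (e : T) (G : set T)
    (gT : finGroupType) :=
  is_group op e G /\
  exists2 f : gT -> T,
    set_bij [set: gT] G f & {morph f : g h / (g * h)%g >-> op g h}.

(* The group law of ['Z_2], seen as a [finGroupType], is addition modulo 2. *)
Definition C2 : finGroupType := 'Z_2.
Definition C2xC2 : finGroupType := (C2 * C2)%type.

(* Main.v *)
Require Import Defs.
From HB Require Import structures.
From mathcomp Require Import all_boot all_order all_algebra all_fingroup.
From mathcomp Require Import boolp classical_sets functions.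
From mathcomp Require Import ring lra zify.

(* If x has squarefree norm prime to an odd prime p, then p^(k-1) x is k-free:
   a prime above p divides p^(k-1) x at most k-1 times.  So p^(k-1) A(x) is
   k-free, and if p does not divide A(x), then no prime above p divides A(x)
   either, as p^(k-1) supplies the k-1 missing factors of a prime of norm p.
   Elements 1 and sqrt(-2) are not divisible by rational integers, hence neither
   are their images under the bijection A; therefore A(1) and A(sqrt(-2)) have
   norm 1 or 2 and A permutes {1, sqrt(-2)} up to signs.  The swap is excluded by
   p = 11: it sends 1 + 3 sqrt(-2), of norm 19, to +-3 +- sqrt(-2), of norm 11. *)

Set Implicit Arguments.
Unset Strict Implicit.
Unset Printing Implicit Defensive.

Import Order.TTheory GRing.Theory Num.Theory.
Local Open Scope ring_scope.
Local Open Scope classical_set_scope.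

Implicit Types x y z : Zsqrtm2.

(** * The norm as a natural number, and coordinates *)

Definition nnorm (x : Zsqrtm2) : nat := `|znorm x|%N.
Arguments nnorm x%_R.

Lemma nnormE x : (nnorm x)%:Z = zre x ^+ 2 + 2 * zim x ^+ 2.
Proof.
rewrite /nnorm gez0_abs // /znorm.
by rewrite addr_ge0 ?sqr_ge0 // mulr_ge0 ?sqr_ge0.
Qed.

Lemma nnormM x y : nnorm (x * y) = (nnorm x * nnorm y)%N.
Proof. by rewrite /nnorm znormM abszM. Qed.

Lemma nnorm1 : nnorm 1 = 1%N.
Proof. by []. Qed.

Lemma nnormX x n : nnorm (x ^+ n) = (nnorm x ^ n)%N.
Proof. by elim: n => // n IH; rewrite exprS nnormM IH expnS. Qed.

Lemma nnorm_conj x : nnorm (zconj x) = nnorm x.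
Proof. by rewrite /nnorm /znorm /= sqrrN. Qed.

Lemma nnorm_unit x : (x \is a GRing.unit) = (nnorm x == 1%N).
Proof.
transitivity (znorm x == 1) => //.
by rewrite -eqz_nat nnormE.
Qed.

Lemma zreM x y : zre (x * y) = zre x * zre y - 2 * (zim x * zim y).
Proof. by []. Qed.

Lemma zimM x y : zim (x * y) = zre x * zim y + zim x * zre y.
Proof. by []. Qed.

Lemma zreD x y : zre (x + y) = zre x + zre y.
Proof. by []. Qed.

Lemma zimD x y : zim (x + y) = zim x + zim y.
Proof. by []. Qed.

Lemma zeqP x y : zre x = zre y -> zim x = zim y -> x = y.
Proof. by case: x y => a b [c d] /= -> ->. Qed.

Lemma zre_intr n : zre (n%:~R) = n.
Proof.
have zreN m : zre (m%:R) = m%:Z /\ zim (m%:R) = 0.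
  elim: m => // m [IH1 IH2]; rewrite mulrS; split.
    by rewrite [LHS]/(1 + zre _) IH1 intS.
  by rewrite [LHS]/(0 + zim _) IH2.
case: n => n; first by case: (zreN n).
by rewrite NegzE rmorphN /= [LHS]/(- zre _); case: (zreN n.+1) => ->.
Qed.

Lemma zim_intr n : zim (n%:~R) = 0.
Proof.
have zimN m : zim (m%:R) = 0.
  by elim: m => // m IH; rewrite mulrS [LHS]/(0 + zim _) IH.
case: n => n; first exact: zimN.
by rewrite NegzE rmorphN /= [LHS]/(- zim _) zimN.
Qed.

Lemma nnorm_eq0 x : nnorm x = 0%N -> x = 0.
Proof.
move=> x0; have := nnormE x; rewrite x0 => /esym/eqP.
rewrite paddr_eq0 ?sqr_ge0 ?(mulr_ge0 _ (sqr_ge0 _)) //.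
rewrite sqrf_eq0 mulf_eq0 sqrf_eq0 /= => /andP[/eqP re0 /eqP im0].
exact: zeqP.
Qed.

Lemma mul_zconj x : x * zconj x = (nnorm x)%:R.
Proof.
rewrite mulrC zconjM; apply: zeqP => /=.
  by rewrite -[_%:R]/((nnorm x)%:Z%:~R) zre_intr nnormE.
by rewrite -[_%:R]/((nnorm x)%:Z%:~R) zim_intr.
Qed.

Lemma nnorm_nat n : nnorm n%:R = (n ^ 2)%N.
Proof.
apply/eqP; rewrite -eqz_nat nnormE -[n%:R]/(n%:Z%:~R) zre_intr zim_intr.
by rewrite expr0n mulr0 addr0 expr2 -PoszM mulnn.
Qed.

Lemma zdvd_nnorm x y : zdvd x y -> (nnorm x %| nnorm y)%N.
Proof. by case=> z ->; rewrite nnormM dvdn_mull. Qed.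

Lemma Zsqrtm2_mulf_eq0 (x y : Zsqrtm2) : x * y = 0 -> y != 0 -> x = 0.
Proof.
move=> xy0 /eqP y0; apply: nnorm_eq0; have : nnorm (x * y) = 0%N by rewrite xy0.
by rewrite nnormM => /eqP; rewrite muln_eq0 => /orP[/eqP//|/eqP/nnorm_eq0].
Qed.

Lemma Zsqrtm2_mulIf (x y z : Zsqrtm2) : z != 0 -> x * z = y * z -> x = y.
Proof.
move=> z0 /eqP; rewrite -subr_eq0 -mulrBl => /eqP /Zsqrtm2_mulf_eq0 /(_ z0)/eqP.
by rewrite subr_eq0 => /eqP.
Qed.

(** * Euclidean division and Bezout combinations *)

Lemma nearest_multiple (n d : int) : 0 < d ->
  exists c, - d <= 2 * (n - c * d) <= d.
Proof.
(* This quotient is the floor of n/d + 1/2, that is, n/d rounded to a nearest integer. *)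
move=> d0; exists ((2 * n + d) %/ (2 * d))%Z.
have := divz_eq (2 * n + d) (2 * d).
have := ltz_pmod (2 * n + d) (d := 2 * d).
have := modz_ge0 (2 * n + d) (d := 2 * d).
set q := (_ %/ _)%Z; set r := (_ %% _)%Z.
move=> h1 h2 h3.
have {}h1 : 0 <= r by apply: h1; lia.
have {}h2 : r < 2 * d by apply: h2; lia.
have e : 2 * (n - q * d) = r - d.
  have -> : 2 * (n - q * d) = (2 * n + d) - q * (2 * d) - d by ring.
  by rewrite h3; ring.
by rewrite e; lia.
Qed.

(** Round both coordinates of x/y. After multiplication by [zconj y], the remainder has coordinates
    of size at most N(y)/2, so its norm is at most (1/4 + 2/4) N(y)^2 < N(y)^2. *)
Lemma Zsqrtm2_edivP x y : y != 0 -> exists c, (nnorm (x - c * y) < nnorm y)%N.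
Proof.
move=> y0; have N0 : (0 < nnorm y)%N.
  by rewrite lt0n; apply/eqP => /nnorm_eq0/eqP; apply/negP.
set d := (nnorm y)%:Z; have d0 : 0 < d by rewrite /d ltz_nat.
have [c1 h1] := nearest_multiple (zre (x * zconj y)) d0.
have [c2 h2] := nearest_multiple (zim (x * zconj y)) d0.
exists (Zsqrtm2_of c1 c2); set c := Zsqrtm2_of _ _.
rewrite -(ltn_pmul2r N0) -[X in (_ * X < _)%N]nnorm_conj -nnormM.
rewrite mulrBl -mulrA mul_zconj -ltz_nat nnormE PoszM -/d.
set r1 := zre (x * zconj y) - c1 * d in h1.
set r2 := zim (x * zconj y) - c2 * d in h2.
have -> : zre (x * zconj y - c * (nnorm y)%:R) = r1.
  rewrite [LHS]/(zre (x * _) - zre (c * _)) /r1; congr (_ - _).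
  by rewrite zreM -[_%:R]/(d%:~R) zre_intr zim_intr mulr0 mulr0 subr0.
have -> : zim (x * zconj y - c * (nnorm y)%:R) = r2.
  rewrite [LHS]/(zim (x * _) - zim (c * _)) /r2; congr (_ - _).
  by rewrite zimM -[_%:R]/(d%:~R) zre_intr zim_intr mulr0 add0r.
clearbody r1 r2 d; nra.
Qed.

(** Euclid's algorithm, by induction on a bound for the norm of [y]. The combination obtained is a
    gcd of [x] and [y]. *)
Lemma Zsqrtm2_Bezout x y : exists u v, zdvd (u * x + v * y) x /\ zdvd (u * x + v * y) y.
Proof.
have [n] := ubnP (nnorm y); elim: n => // n IH in x y *; rewrite ltnS => le_n.
have [->|y0] := eqVneq y 0.
  exists 1, 0; rewrite mulr0 addr0 mul1r.
  by split; [exists 1; rewrite mul1r | exists 0; rewrite mul0r].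
have [c lt_c] := Zsqrtm2_edivP x y0.
have [u [v [[a ea] [b eb]]]] := IH y (x - c * y) (leq_trans lt_c le_n).
exists v, (u - v * c).
have -> : v * x + (u - v * c) * y = u * y + v * (x - c * y) by ring.
split; last by exists a.
exists (b + c * a); rewrite mulrDl -eb -mulrA -ea; ring.
Qed.

(** * Conjugation, and primes lying over a rational prime *)

Lemma zconj_mul x y : zconj (x * y) = zconj x * zconj y.
Proof. by apply: zeqP; rewrite /= ?zreM ?zimM /=; ring. Qed.

Lemma zconjK : involutive zconj.
Proof. by case=> a b; rewrite /zconj /= opprK. Qed.

Lemma zconj_nat n : zconj n%:R = n%:R.
Proof.
by apply: zeqP => //=; rewrite -[n%:R]/(n%:Z%:~R) zim_intr oppr0.
Qed.

Lemma zdvd_trans x y z : zdvd x y -> zdvd y z -> zdvd x z.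
Proof. by move=> [a ->] [b ->]; exists (b * a); rewrite mulrA. Qed.

Lemma nnorm1_mulK d z : nnorm d = 1%N -> z = z * zconj d * d.
Proof. by move=> d1; rewrite -mulrA [zconj d * d]mulrC mul_zconj d1 mulr1. Qed.

(** The cofactor has norm 1, so it is a unit whose inverse is its conjugate. *)
Lemma zdvd_nnorm_eq d x : (0 < nnorm d)%N -> zdvd d x -> nnorm d = nnorm x ->
  zdvd x d.
Proof.
move=> d0 [a ->]; rewrite nnormM => /esym/eqP.
rewrite -[X in _ == X]mul1n eqn_pmul2r // => /eqP a1.
by exists (zconj a); rewrite mulrA [zconj a * a]mulrC mul_zconj a1 mul1r.
Qed.

(** If g divides xy, the norm of a gcd d of g and x divides the prime N(g). Either d is a unit, and
    the Bezout combination multiplied by y shows that g divides y, or d is associate to g, and g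
    divides x. *)
Lemma zprime_nnorm g : prime (nnorm g) -> zprime g.
Proof.
move=> pg; have g0 := prime_gt0 pg; split.
- by apply/eqP => g_eq; move: g0; rewrite g_eq.
- by rewrite nnorm_unit neq_ltn prime_gt1 // orbT.
move=> x y [w gxy]; have [u [v [dg dx]]] := Zsqrtm2_Bezout g x.
set d := u * g + v * x in dg dx.
have /primeP[_ /(_ (nnorm d) (zdvd_nnorm dg))/orP[/eqP d1|/eqP dN]] := pg.
  right; exists (zconj d * (u * y + v * w)).
  rewrite [LHS](nnorm1_mulK y d1); set c := zconj d.
  have -> : y * c * d = c * (u * y * g + v * (x * y)) by rewrite /d; ring.
  by rewrite gxy; ring.
by left; apply: zdvd_trans dx; apply: zdvd_nnorm_eq => //; rewrite dN.
Qed.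

Lemma zdvd_conj x y : zdvd x y -> zdvd (zconj x) (zconj y).
Proof. by case=> a ->; exists (zconj a); rewrite zconj_mul. Qed.

(** The prime sought is a gcd d of p and z, whose norm divides p^2. If N(d) = 1, then p divides
    conj(z), because it divides z conj(z); if N(d) = p^2, then d is associate to p. Both make p
    divide z, so N(d) = p. *)
Lemma zprime_dvd_of_nnorm p z : prime p -> (p %| nnorm z)%N -> ~ zdvd p%:R z ->
  exists g, [/\ zprime g, nnorm g = p & zdvd g z].
Proof.
move=> pp /dvdnP[m Nz] pNz.
have [u [v [dp dz]]] := Zsqrtm2_Bezout p%:R z.
set d := u * p%:R + v * z in dp dz.
have := zdvd_nnorm dp; rewrite nnorm_nat => /(dvdn_pfactor _ _ pp)[[|[|[|e]]]] //= _ Nd.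
- case: pNz; rewrite expn0 in Nd.
  have : zdvd p%:R (zconj z).
    exists (zconj d * (u * zconj z + v * m%:R)).
    rewrite [LHS](nnorm1_mulK (zconj z) Nd); set c := zconj d.
    have -> : zconj z * c * d = c * (u * zconj z * p%:R + v * (z * zconj z)).
      by rewrite /d; ring.
    by rewrite mul_zconj Nz natrM; ring.
  by move=> /zdvd_conj; rewrite zconjK zconj_nat.
- by exists d; split=> //; apply: zprime_nnorm; rewrite Nd.
- case: pNz; apply: zdvd_trans dz; apply: zdvd_nnorm_eq => //.
    by rewrite Nd expn_gt0 prime_gt0.
  by rewrite Nd nnorm_nat.
Qed.

Lemma zprime_dvdX q x n : zprime q -> zdvd q (x ^+ n) -> zdvd q x.
Proof.
move=> [q0 qNu qM]; elim: n => [|n IH]; last by rewrite exprS => /qM[|/IH].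
rewrite expr0 => /zdvd_nnorm; rewrite nnorm1 dvdn1 => /eqP q1.
by move: qNu; rewrite nnorm_unit q1.
Qed.

(** * Ramification and the k-free test elements *)

Lemma nnorm_absz x : nnorm x = (`|zre x| ^ 2 + 2 * `|zim x| ^ 2)%N.
Proof.
by apply/eqP; rewrite -eqz_nat nnormE; case: x => a b /=; lia.
Qed.

(** Odd primes do not ramify. If q divided its conjugate, it would divide the trace 2 Re(q); then p
    = N(q) would divide Re(q), hence also Im(q), and p^2 would divide N(q) = p. *)
Lemma zprime_Ndvd_conj q : prime (nnorm q) -> odd (nnorm q) -> ~ zdvd q (zconj q).
Proof.
move=> pq oq [w qc]; set p := nnorm q in pq oq.
have p2 : ~~ (p %| 2)%N.
  by rewrite dvdn_prime2 //; apply/eqP => e; move: oq; rewrite e.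
have pa : (p %| `|zre q|)%N.
  have : (w + 1) * q = (2 * zre q)%:~R.
    rewrite mulrDl -qc mul1r; apply: zeqP.
      by rewrite zre_intr zreD mulr_natl mulr2n.
    by rewrite zim_intr zimD addNr.
  move=> /(congr1 nnorm); rewrite nnormM -/p [RHS]nnorm_absz zre_intr zim_intr.
  rewrite muln0 addn0 abszM => e.
  have : (p %| (2 * `|zre q|) ^ 2)%N by rewrite -e dvdn_mull.
  by rewrite Euclid_dvdX // andbT Euclid_dvdM // (negbTE p2).
have pb : (p %| `|zim q|)%N.
  have : (p %| 2 * `|zim q| ^ 2)%N.
    have := dvdnn p; rewrite {2}/p nnorm_absz dvdn_addr //.
    by rewrite Euclid_dvdX // pa.
  by rewrite Euclid_dvdM // (negbTE p2) /= Euclid_dvdX // andbT.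
have : (p ^ 2 %| p)%N.
  by rewrite {2}/p nnorm_absz dvdn_add ?dvdn_exp2r // dvdn_mull // dvdn_exp2r.
by move/(dvdn_leq (prime_gt0 pq)); rewrite leqNgt -{1}[p]expn1 ltn_exp2l // prime_gt1.
Qed.

Lemma kfree_prime_expM k p x : (2 <= k)%N -> prime p -> odd p ->
  ~~ (p %| nnorm x)%N -> (forall l, prime l -> ~~ (l ^ 2 %| nnorm x)%N) ->
  kfree k (p%:R ^+ k.-1 * x).
Proof.
move=> k2 pp op pNx sqf [q qp qdvd].
have k0 : (0 < k)%N by apply: leq_trans k2.
have Nq : (nnorm q ^ k %| p ^ (2 * k.-1) * nnorm x)%N.
  by move: (zdvd_nnorm qdvd); rewrite nnormM !nnormX nnorm_nat expnM.
(* For l other than p, l^k divides p^(2(k-1)) N(x) and is coprime to p, so l^2 divides N(x), which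
   is squarefree. *)
have onlyp l : prime l -> (l %| nnorm q)%N -> l = p.
  move=> pl lq; apply/eqP; apply: contraT => lp.
  have /negP[] := sqf l pl; apply: dvdn_trans (dvdn_exp2l l k2) _.
  have cop : coprime (l ^ k) (p ^ (2 * k.-1)).
    by rewrite coprimeXl // coprimeXr // prime_coprime // dvdn_prime2.
  by rewrite -(Gauss_dvdr _ cop); apply: dvdn_trans Nq; apply: dvdn_exp2r.
(* Otherwise p^(2k) divides p^(2(k-1)) N(x), and again p^2 divides N(x). *)
have Np2 : ~~ (p ^ 2 %| nnorm q)%N.
  apply/negP => p2q; have /negP[] := sqf p pp.
  have := dvdn_trans (dvdn_exp2r k p2q) Nq.
  have -> : ((p ^ 2) ^ k = p ^ (2 * k.-1) * p ^ 2)%N.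
    by rewrite -expnM -expnD -{1}(prednK k0) mulnS addnC.
  by rewrite dvdn_pmul2l // expn_gt0 prime_gt0.
have [q0 qNu qM] := qp.
have Nq1 : (nnorm q != 1)%N by rewrite -nnorm_unit.
have Nq0 : (0 < nnorm q)%N.
  by rewrite lt0n; apply: contra_neq q0 => /nnorm_eq0.
have pq : nnorm q = p.
  have := pdiv_dvd (nnorm q); have pd : prime (pdiv (nnorm q)).
    by apply: pdiv_prime; case: (nnorm q) Nq1 Nq0 => [|[|]].
  rewrite (onlyp _ pd (pdiv_dvd _)) => /dvdnP[m em].
  have [m1|m1] := eqVneq m 1%N; first by rewrite em m1 mul1n.
  have pm : prime (pdiv m).
    by apply: pdiv_prime; move: Nq0; rewrite em; case: (m) m1 => [|[|]].
  case/negP: Np2; rewrite em expnS expn1 dvdn_mul //.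
  by rewrite -{1}(onlyp _ pm) ?pdiv_dvd // em dvdn_mulr // pdiv_dvd.
(* Write p = q conj(q) and cancel q^(k-1): the remaining factor q must divide conj(q)^(k-1) x. It
   divides neither conj(q), as p is odd, nor x, as p does not divide N(x). *)
case: qdvd => z; rewrite -{1}pq -mul_zconj exprMn.
rewrite -{3}(prednK k0) exprS => e.
have : zdvd q (zconj q ^+ k.-1 * x).
  exists z; apply: (@Zsqrtm2_mulIf _ _ (q ^+ k.-1)).
    by apply/eqP => /(congr1 nnorm)/eqP; rewrite nnormX expn_eq0 -leqn0 leqNgt Nq0.
  by transitivity (q ^+ k.-1 * zconj q ^+ k.-1 * x); [ring | rewrite e; ring].
case/qM => [/(zprime_dvdX qp)|/zdvd_nnorm]; last by rewrite pq (negbTE pNx).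
by apply: zprime_Ndvd_conj; rewrite pq.
Qed.

Lemma prime_Ndvd_sqr r l : prime r -> prime l -> ~~ (l ^ 2 %| r)%N.
Proof.
move=> pr pl; apply/negP => l2r.
have := dvdn_trans (dvdn_exp (ltn0Sn 1) (dvdnn l)) l2r.
rewrite dvdn_prime2 // => /eqP lr; move: (dvdn_leq (prime_gt0 pr) l2r).
by rewrite -lr leqNgt -{1}[l]expn1 ltn_exp2l // prime_gt1.
Qed.

(** * Linear maps and their action on divisibility *)

Definition zsqrtm2 := Zsqrtm2_of 0 1.

(** Trades the scaling of the module structure over the integers for multiplication in the ring. *)
Lemma zlinearP A : zlinear A ->
  forall (n : int) x y, A (n%:~R * x + y) = n%:~R * A x + A y.
Proof.
move=> linA n x y; have := linA n x y; rewrite !scalezrE => h.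
by rewrite !mulrzl.
Qed.

Lemma zlinear_intr A :
  (forall (n : int) x y, A (n%:~R * x + y) = n%:~R * A x + A y) -> zlinear A.
Proof. by move=> linA n x y; have := linA n x y; rewrite !mulrzl. Qed.

Lemma zlinear0 A : zlinear A -> A 0 = 0.
Proof.
move=> /zlinearP/(_ 1 0 0); rewrite !mul1r addr0 => h.
by apply: (addrI (A 0)); rewrite addr0 -h.
Qed.

Lemma zlinearZ A : zlinear A -> forall (n : int) x, A (n%:~R * x) = n%:~R * A x.
Proof.
by move=> linA n x; rewrite -[n%:~R * x]addr0 zlinearP // zlinear0 // addr0.
Qed.

Lemma zlinearE A : zlinear A ->
  forall x, A x = (zre x)%:~R * A 1 + (zim x)%:~R * A zsqrtm2.
Proof.
move=> linA x; rewrite -(zlinearZ linA (zim x)) -(zlinearP linA); congr A.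
by apply: zeqP; rewrite ?zreD ?zimD ?zreM ?zimM zre_intr zim_intr ?zre_intr ?zim_intr /=; ring.
Qed.

(** The inverse of [A] carries the quotient back, since [A] commutes with multiplication by n. *)
Lemma zlinear_zdvd A (n : nat) x : zlinear A -> bijective A ->
  zdvd n%:R (A x) -> zdvd n%:R x.
Proof.
move=> linA [B AK BK] [w e]; exists (B w); apply: (can_inj AK).
by rewrite mulrC -[n%:R]/(n%:Z%:~R) zlinearZ // BK e mulrC.
Qed.

(** If p divided N(A(x)), some prime g of norm p would divide A(x). As p^(k-1) = g^(k-1)
    conj(g)^(k-1), g^k would divide p^(k-1) A(x), the image of a k-free element. *)
Lemma stab_Ndvd_nnorm A k p x : (2 <= k)%N -> zlinear A ->
  A @` kfree k `<=` kfree k -> prime p -> odd p ->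
  ~~ (p %| nnorm x)%N -> (forall l, prime l -> ~~ (l ^ 2 %| nnorm x)%N) ->
  ~ zdvd p%:R (A x) -> ~~ (p %| nnorm (A x))%N.
Proof.
move=> k2 linA AV pp op pNx sqf pNAx; apply/negP => pAx.
have [g [gp Ng [w Ax]]] := zprime_dvd_of_nnorm pp pAx pNAx.
have : kfree k (A (p%:R ^+ k.-1 * x)).
  by apply: AV; exists (p%:R ^+ k.-1 * x) => //; apply: kfree_prime_expM.
rewrite -natrX -[_%:R]/((p ^ k.-1)%N%:Z%:~R) zlinearZ // => -[]; exists g => //.
exists (zconj g ^+ k.-1 * w); rewrite Ax -[_%:~R]/((p ^ k.-1)%:R) natrX -Ng.
rewrite -mul_zconj exprMn -[in RHS](prednK (ltnW k2)) exprS; ring.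
Qed.

(** * Elements of norm 1 and 2 *)

Lemma nnorm_eq1 x : nnorm x = 1%N -> x = 1 \/ x = -1.
Proof.
move=> x1; have := nnormE x; rewrite x1; case: x {x1} => a b /= e.
have b0 : b = 0 by nia.
have [a1|a1] : a = 1 \/ a = -1 by nia.
  by left; apply: zeqP.
by right; apply: zeqP => /=; rewrite ?a1 ?b0.
Qed.

Lemma nnorm_eq2 x : nnorm x = 2%N -> x = zsqrtm2 \/ x = - zsqrtm2.
Proof.
move=> x2; have := nnormE x; rewrite x2; case: x {x2} => a b /= e.
have a1 : a = -1 \/ a = 0 \/ a = 1.
  by have : -2 < a < 2; [nia | lia].
have b1 : b = 1 \/ b = -1.
  have : -2 < b < 2 by nia.
  have : b <> 0 by move=> b0; move: e; rewrite b0; case: a1 => [->|[->|->]].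
  lia.
have a0 : a = 0 by move: e; case: b1 => ->; case: a1 => [->|[->|->]].
by case: b1 => ->; [left|right]; apply: zeqP => /=; rewrite ?a0.
Qed.

Lemma dvdn_absz2 (a : int) : (2 %| `|a|)%N -> exists c, a = 2 * c.
Proof. by move=> /dvdnP[c e]; exists (if 0 <= a then c%:Z else - c%:Z); case: ifP; lia. Qed.

(** The norm is a power of 2. If 4 divides a^2 + 2b^2, then a is even, hence b is even too, and 2
    divides x; so the norm is at most 2. *)
Lemma nnorm_primitive_le2 x : (forall p, prime p -> ~ zdvd p%:R x) ->
  (forall p, prime p -> odd p -> ~~ (p %| nnorm x)%N) ->
  nnorm x = 1%N \/ nnorm x = 2%N.
Proof.
move=> prim oddN; have N0 : (0 < nnorm x)%N.
  by rewrite lt0n; apply/eqP => N0; have := oddN 3 isT isT; rewrite N0.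
have only2 l : prime l -> (l %| nnorm x)%N -> l = 2%N.
  by move=> pl; have [//|ol] := even_prime pl; rewrite (negbTE (oddN l pl ol)).
have [|N1] := eqVneq (nnorm x) 1%N; [by left|right].
have pd : prime (pdiv (nnorm x)).
  by apply: pdiv_prime; case: (nnorm x) N1 N0 => [|[|]].
have := pdiv_dvd (nnorm x); rewrite (only2 _ pd (pdiv_dvd _)) => /dvdnP[m em].
have [m1|m1] := eqVneq m 1%N; first by rewrite em m1.
have pm : prime (pdiv m).
  by apply: pdiv_prime; move: N0; rewrite em; case: (m) m1 => [|[|]].
have p2 : pdiv m = 2%N by apply: only2; rewrite // em dvdn_mulr // pdiv_dvd.
have : (2 * 2 %| nnorm x)%N by rewrite em dvdn_mul // -p2 pdiv_dvd.
rewrite nnorm_absz => d4.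
have a2 : (2 %| `|zre x|)%N.
  have : (2 %| `|zre x| ^ 2)%N.
    by rewrite -(@dvdn_addl (2 * `|zim x| ^ 2)) ?dvdn_mulr // (dvdn_trans _ d4).
  by rewrite Euclid_dvdX // andbT.
have b2 : (2 %| `|zim x|)%N.
  have : (2 * 2 %| 2 * `|zim x| ^ 2)%N.
    by move: d4; rewrite dvdn_addr // (dvdn_exp2r 2 a2).
  by rewrite dvdn_pmul2l // Euclid_dvdX // andbT.
case: (prim 2%N isT); have [[c ec] [d ed]] := (dvdn_absz2 a2, dvdn_absz2 b2).
exists (Zsqrtm2_of c d); apply: zeqP.
  by rewrite zreM -[2%:R]/(2%:Z%:~R) zre_intr zim_intr ec /=; ring.
by rewrite zimM -[2%:R]/(2%:Z%:~R) zre_intr zim_intr ed /=; ring.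
Qed.

Lemma nnorm_le2_primitive x : (nnorm x = 1%N \/ nnorm x = 2%N) ->
  forall p, prime p -> ~ zdvd p%:R x.
Proof.
move=> Nx p pp /zdvd_nnorm; rewrite nnorm_nat => /dvdn_leq.
have : (2 ^ 2 <= p ^ 2)%N by rewrite leq_exp2r // prime_gt1.
by case: Nx => -> p4 /(_ isT); rewrite leqNgt (leq_trans _ p4).
Qed.

Lemma stab_nnorm_le2 A k x : (2 <= k)%N -> zlinear A -> bijective A ->
  A @` kfree k `<=` kfree k -> (nnorm x = 1%N \/ nnorm x = 2%N) ->
  nnorm (A x) = 1%N \/ nnorm (A x) = 2%N.
Proof.
move=> k2 linA bijA AV Nx.
have primA p : prime p -> ~ zdvd p%:R (A x).
  by move=> pp /(zlinear_zdvd linA bijA); apply: nnorm_le2_primitive.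
apply: nnorm_primitive_le2 => // p pp op; apply: (stab_Ndvd_nnorm k2 linA AV) => //.
- case: Nx => ->; first by rewrite dvdn1; case: p pp {op} => [|[]].
  by rewrite dvdn_prime2 //; apply/eqP => e; move: op; rewrite e.
- move=> l pl; case: Nx => ->; last exact: prime_Ndvd_sqr.
  by rewrite dvdn1 -mulnn muln_eq1; case: l pl => [|[]].
- exact: primA.
Qed.

(** * Determination of A *)

Lemma zdvd_nat_coords (n : nat) x : zdvd n%:R x ->
  (n %| `|zre x|)%N /\ (n %| `|zim x|)%N.
Proof.
move=> [w ->]; rewrite zreM zimM -[n%:R]/(n%:Z%:~R) zre_intr zim_intr.
by rewrite !mulr0 subr0 add0r !abszM !dvdn_mull.
Qed.

Lemma stab_form A k : (2 <= k)%N -> zlinear A -> bijective A ->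
  A @` kfree k `<=` kfree k ->
  exists e s, [/\ e = 1 \/ e = -1, s = id \/ s = zconj & A = fun x => e * s x].
Proof.
move=> k2 linA bijA AV.
have imA x : (nnorm x = 1%N \/ nnorm x = 2%N) ->
    [\/ A x = 1, A x = -1, A x = zsqrtm2 | A x = - zsqrtm2].
  move=> Nx; have := stab_nnorm_le2 k2 linA bijA AV Nx.
  by case=> [/nnorm_eq1|/nnorm_eq2] [->|->];
    [constructor 1|constructor 2|constructor 3|constructor 4].
have injA := bij_inj bijA.
set w := Zsqrtm2_of 1 3.
(* N(w) = 19 is prime and different from 11, and 11 does not divide the first coordinate of w, so 11
   cannot divide N(A(w)). *)
have w11 : nnorm (A w) <> 11%N.
  move=> Aw; suff: ~~ (11 %| nnorm (A w))%N by rewrite Aw.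
  apply: (stab_Ndvd_nnorm k2 linA AV) => //.
    by move=> l; apply: prime_Ndvd_sqr.
  by move/(zlinear_zdvd linA bijA)/zdvd_nat_coords => -[].
(* By injectivity, since sqrt(-2) is not a rational integer. *)
have sA (c : int) : A zsqrtm2 = c%:~R * A 1 -> False.
  by rewrite -zlinearZ // => /injA/(congr1 zim); rewrite zimM zim_intr /= mulr0 add0r mul0r.
have Aw : A w = A 1 + 3%:~R * A zsqrtm2 by rewrite zlinearE // mul1r.
have AE := zlinearE linA.
have [|||] := imA 1 (or_introl erefl) => A1;
have [|||] := imA zsqrtm2 (or_intror erefl) => As;
rewrite A1 As in AE Aw sA w11;
(* Of the 16 cases, [sA] removes the eight with A(sqrt(-2)) = A(1) or -A(1), and [w11] removes the
   four swaps. *)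
try by [case: (sA 1) | case: (sA (-1)) | case: w11; rewrite Aw].
- exists 1, id; split; [by left|by left|apply/funext => x; rewrite AE].
  by apply: zeqP; rewrite ?zreD ?zimD ?zreM ?zimM ?zre_intr ?zim_intr /=; ring.
- exists 1, zconj; split; [by left|by right|apply/funext => x; rewrite AE].
  by apply: zeqP; rewrite ?zreD ?zimD ?zreM ?zimM ?zre_intr ?zim_intr /=; ring.
- exists (-1), zconj; split; [by right|by right|apply/funext => x; rewrite AE].
  by apply: zeqP; rewrite ?zreD ?zimD ?zreM ?zimM ?zre_intr ?zim_intr /=; ring.
- exists (-1), id; split; [by right|by left|apply/funext => x; rewrite AE].
  by apply: zeqP; rewrite ?zreD ?zimD ?zreM ?zimM ?zre_intr ?zim_intr /=; ring.
Qed.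

(** * Invariance of k-freeness under conjugation and sign *)

Lemma zprime_conj p : zprime p -> zprime (zconj p).
Proof.
move=> [p0 pNu pM]; split.
- by apply: contra_neq p0 => /(congr1 zconj); rewrite zconjK => ->; apply: zeqP.
- by rewrite nnorm_unit nnorm_conj -nnorm_unit.
move=> x y /zdvd_conj; rewrite zconjK zconj_mul => /pM.
by case=> /zdvd_conj; rewrite zconjK; [left|right].
Qed.

Lemma zconjX x n : zconj (x ^+ n) = zconj x ^+ n.
Proof.
elim: n => [|n IH]; first exact: (zconj_nat 1).
by rewrite !exprS zconj_mul IH.
Qed.

Lemma kfree_conj k x : kfree k x -> kfree k (zconj x).
Proof.
move=> xk [q qp /zdvd_conj]; rewrite zconjX zconjK => qx.
by apply: xk; exists (zconj q) => //; apply: zprime_conj.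
Qed.

Lemma kfreeN k x : kfree k x -> kfree k (- x).
Proof.
move=> xk [q qp [z e]]; apply: xk; exists q => //; exists (- z).
by rewrite mulNr -e opprK.
Qed.

(** * Group structures transported from a finite group *)

Section GroupIsog.
Variables (T : Type) (op : T -> T -> T) (e : T) (gT : finGroupType).

(** Every group axiom on the image is the axiom of [gT] pushed through [f]; nothing is assumed of
    [op] outside the image. *)
Lemma group_isog_range (f : gT -> T) : injective f -> f 1%g = e ->
  {morph f : g h / (g * h)%g >-> op g h} -> group_isog op e (range f) gT.
Proof.
move=> f_inj f1 fM; split; last first.
  exists f => //; split=> [x _|x y _ _|_ [x _ <-]]; first by exists x.
    exact: f_inj.
  by exists x.
split=> [|_ _ [x _ <-] [y _ <-]|_ _ _ [x _ <-] [y _ <-] [z _ <-]|_ [x _ <-]|_ [x _ <-]].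
- by exists 1%g.
- by exists (x * y)%g.
- by rewrite -!fM mulgA.
- by rewrite -f1 -!fM mul1g mulg1.
- by exists (f x^-1%g); [exists x^-1%g | rewrite -!fM mulVg mulgV].
Qed.

End GroupIsog.

(** The neutral element [1%g] is the residue 0, while the ring unit [1 : 'Z_2] is the generator. *)
Lemma C2P (g : C2) : g = 1%g \/ g = (1 : 'Z_2).
Proof. by case: g => [[|[|]]] // i; [left|right]; apply: val_inj. Qed.

Lemma group_isog_C2 (T : Type) (op : T -> T -> T) (e t : T) : e <> t ->
  op e e = e -> op e t = t -> op t e = t -> op t t = e ->
  group_isog op e [set e; t] C2.
Proof.
move=> et ee e_t t_e tt; pose f (g : C2) := if g == 1%g then e else t.
have -> : [set e; t] = range f.
  apply/seteqP; split=> [x [->|->]|_ [x _ <-]]; first by exists 1%g.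
    by exists (1 : 'Z_2).
  by rewrite /f; case: ifP; [left|right].
apply: group_isog_range => // x y; case: (C2P x) => ->; case: (C2P y) => -> //=.
  by move/esym.
Qed.

(** * Units, and the stabiliser as an image of the Klein four-group *)

Lemma unit_set : [set x : Zsqrtm2 | x \is a GRing.unit] = [set 1; -1].
Proof.
apply/seteqP; split=> x /=; first by rewrite nnorm_unit => /eqP/nnorm_eq1.
by case=> ->; rewrite nnorm_unit.
Qed.

(** Indexing the four maps by [C2xC2] makes the parametrisation itself the required isomorphism. *)
Definition stab_map (g : C2xC2) : Zsqrtm2 -> Zsqrtm2 :=
  fun x => (if g.1 == 1%g then 1 else -1) * (if g.2 == 1%g then id else zconj) x.

(** The value at 1 reveals the sign; the value at sqrt(-2) then reveals whether conjugation
    occurs. *)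
Lemma stab_map_inj : injective stab_map.
Proof.
move=> [a b] [c d] e.
move: (congr1 (fun F => F 1) e) (congr1 (fun F => F zsqrtm2) e); rewrite /stab_map /=.
by case: (C2P a) => ->; case: (C2P b) => ->; case: (C2P c) => ->; case: (C2P d) => ->.
Qed.

Lemma stab_mapM : {morph stab_map : g h / (g * h)%g >-> g \o h}.
Proof.
move=> [a b] [c d]; apply/funext => x; rewrite /stab_map /=.
by case: (C2P a) => ->; case: (C2P b) => ->; case: (C2P c) => ->; case: (C2P d) => -> /=;
  apply: zeqP; rewrite /= ?zreM ?zimM /=; ring.
Qed.

Lemma stab_mapK g : involutive (stab_map g).
Proof.
case: g => a b x; rewrite /stab_map /=.
by case: (C2P a) => ->; case: (C2P b) => -> /=;
  apply: zeqP; rewrite /= ?zreM ?zimM /=; ring.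
Qed.

Lemma stab_map_linear g : zlinear (stab_map g).
Proof.
case: g => a b; apply: zlinear_intr => n x y; rewrite /stab_map /=.
by case: (C2P a) => ->; case: (C2P b) => -> /=; apply: zeqP;
  do !rewrite ?(zreD, zimD, zreM, zimM) /=; rewrite !(zre_intr, zim_intr); ring.
Qed.

(** One inclusion suffices, because each map is its own inverse. *)
Lemma stab_map_image k g : stab_map g @` kfree k = kfree k.
Proof.
have sub x : kfree k x -> kfree k (stab_map g x).
  move=> xk; rewrite /stab_map; case: ifP => _; case: ifP => _;
    rewrite ?mul1r ?mulN1r //=; [exact: kfree_conj | exact: kfreeN |].
  exact/kfreeN/kfree_conj.
apply/seteqP; split=> [_ [x xk <-]|x xk]; first exact: sub.
by exists (stab_map g x); [apply: sub | rewrite stab_mapK].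
Qed.

Lemma range_stab_map : range stab_map =
  [set A | exists e s, [/\ [set 1; -1] e, [set id; zconj] s & A = fun x => e * s x]].
Proof.
apply/seteqP; split=> [_ [[a b] _ <-]|A [e [s [+ + ->]]]].
  exists (if a == 1%g then 1 else -1), (if b == 1%g then id else zconj).
  by split=> //; case: ifP; [left|right|left|right].
by case=> ->; case=> ->; [exists (1%g, 1%g)|exists (1%g, (1 : 'Z_2))|
  exists ((1 : 'Z_2), 1%g)|exists ((1 : 'Z_2), (1 : 'Z_2))].
Qed.

Lemma stab_range k : (2 <= k)%N -> stab (kfree k) = range stab_map.
Proof.
move=> k2; apply/seteqP; split=> [A [linA bijA AV]|_ [g _ <-]].
  by rewrite range_stab_map; apply: stab_form k2 linA bijA AV.
split; [exact: stab_map_linear | | by rewrite stab_map_image].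
exact: inv_bij (stab_mapK g).
Qed.

Theorem proposition2p1 (k : nat) (hk : (2 <= k)%N) :
  let V := kfree k in
  let units : set Zsqrtm2 := [set e | e \is a GRing.unit] in
  let autos : set (Zsqrtm2 -> Zsqrtm2) := [set id; zconj] in
  let comp := fun A B : Zsqrtm2 -> Zsqrtm2 => A \o B in
  [/\ units = [set 1; -1] /\ group_isog *%R 1 units C2,
      group_isog comp id autos C2,
      forall A : Zsqrtm2 -> Zsqrtm2,
        zlinear A -> bijective A -> A @` V `<=` V ->
        (exists e, exists s, [/\ units e, autos s & A = fun x => e * s x]) /\
        A @` V = V,
      stab V = [set A | exists e, exists s,
                  [/\ units e, autos s & A = fun x => e * s x]] &
      group_isog comp id (stab V) C2xC2].
Proof.
move=> V units autos comp.
have unitsE : units = [set 1; -1] by exact: unit_set.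
have formE : [set A | exists e s, [/\ units e, autos s & A = fun x => e * s x]] =
    range stab_map by rewrite unitsE range_stab_map.
have stabE : stab V = range stab_map by exact: stab_range.
split.
- by split=> //; rewrite unitsE; apply: group_isog_C2 => //; rewrite ?mulrNN ?mul1r ?mulr1.
- apply: group_isog_C2 => //; first by move/(congr1 (fun F => F zsqrtm2)).
  by apply/funext => x; apply: zconjK.
- move=> A linA bijA AV; have : stab V A by split.
  rewrite stabE => Ar; split; last by case: Ar => g _ <-; apply: stab_map_image.
  by rewrite -formE in Ar.
- by rewrite stabE formE.
- rewrite stabE; apply: group_isog_range.
  + exact: stab_map_inj.
  + by apply/funext => x; rewrite /stab_map /= mul1r.
  + exact: stab_mapM.
Qed.
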